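(* Suppose that the following holds: for every fixed integer $t\ge 0$ there is $n_0(t)$ such that for every $n\ge n_0(t)$, every $n$-element set $A$ of positive integers, all of whose subsets have distinct sums modulo $N=2^n+t$, satisfies $\max A\ge N/3$. Then for every integer $t\ge 0$ there is $i_0=i_0(t)$ such that for every $n$ and every set $A=\{a_1,a_2,\ldots,a_n\}$ of positive integers with $a_1<a_2<\cdots<a_n$, whose subsets all have distinct sums (as integers) and with $\sum_{i=1}^n a_i<2^n+t$, we have $$2^{i-1}\le a_i\le 2^{i-1}+t\qquad\text{for every } i \text{ with } i_0\le i\le n.$$
   Context: Subsets include the empty set, whose sum is $0$. *)

(* Defs.v *)
From mathcomp Require Import all_boot all_order all_algebra.
From mathcomp Require Import finmap.

Set Implicit Arguments.
Unset Strict Implicit.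
Unset Printing Implicit Defensive.

Local Open Scope fset_scope.

Definition subset_sum (B : {fset nat}) : nat := \sum_(b <- B) b.

Definition distinct_subset_sums (A : {fset nat}) : Prop :=
  forall B C : {fset nat}, B `<=` A -> C `<=` A ->
    subset_sum B = subset_sum C -> B = C.

Definition distinct_subset_sums_mod (N : nat) (A : {fset nat}) : Prop :=
  forall B C : {fset nat}, B `<=` A -> C `<=` A ->
    subset_sum B = subset_sum C %[mod N] -> B = C.

Definition positive_elements (A : {fset nat}) : Prop :=
  forall x : nat, x \in A -> 0 < x.

(* The maximum of the empty set is 0. *)
Definition fset_max (A : {fset nat}) : nat := \max_(x <- A) x.

(* Main.v *)
Require Import Defs.
From mathcomp Require Import all_boot all_order all_algebra.
From mathcomp Require Import finmap.
From mathcomp Require Import zify.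

(** Write [S_i = a_1 + ... + a_i], and let [n0] be the bound that the hypothesis
    supplies for [t].  The invariant [S_i < 2 ^ i + t] holds at [i = n] and is
    pushed down to every [i >= n0], with the same [t] all the way.

    Let [m = a_i] be the largest element of the prefix [{a_1, ..., a_i}] and
    [B] the set of the others.  All subset sums of the prefix are below
    [N = 2 ^ i + t], so they are distinct modulo [N], and the hypothesis gives
    [S_i < N <= 3 * m].  Hence the elements of [B] have sum less than [2 * m].
    Two subset sums of [B] congruent modulo [m] are then equal or differ by
    exactly [m]; the latter would make two subset sums of the prefix coincide,
    one using [m] and the other not.  So the [2 ^ i.-1] subset sums of [B] are
    distinct modulo [m] ([distinct_subset_sums_mod_last]), and counting
    residues ([card_distinct_subset_sums_mod]) gives [2 ^ i.-1 <= a_i].  This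
    is the lower bound, and subtracting it from [S_i] yields the invariant at
    [i.-1].  The upper bound follows because the [2 ^ i.-1] distinct subset
    sums of [B] force [S_(i.-1) >= 2 ^ i.-1 - 1]. *)

Lemma subset_sum_fsetU1 (m : nat) (B : {fset nat}) :
  m \notin B -> subset_sum (m |` B)%fset = m + subset_sum B.
Proof. exact: big_fsetU1. Qed.

Lemma leq_subset_sum (B A : {fset nat}) :
  (B `<=` A)%fset -> subset_sum B <= subset_sum A.
Proof.
move=> /fsubsetP sBA.
by apply: (uniq_sub_le_big leqnn (fun x y => leq_addr y x)); rewrite ?fset_uniq.
Qed.

Lemma distinct_subset_sumsS (B A : {fset nat}) :
  (B `<=` A)%fset -> distinct_subset_sums A -> distinct_subset_sums B.
Proof.
by move=> sBA dA C D sC sD; apply: dA; apply: fsubset_trans sBA.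
Qed.

Lemma distinct_subset_sums_mod_big (N : nat) (A : {fset nat}) :
  distinct_subset_sums A -> subset_sum A < N -> distinct_subset_sums_mod N A.
Proof.
move=> dA ltAN B C sB sC.
rewrite !modn_small; [exact: dA | | ]; apply: leq_ltn_trans ltAN;
  exact: leq_subset_sum.
Qed.

Lemma card_distinct_subset_sums_mod (N : nat) (A : {fset nat}) :
  0 < N -> distinct_subset_sums_mod N A -> 2 ^ #|` A| <= N.
Proof.
move=> N_gt0 dA; rewrite -card_fpowerset -(size_iota 0 N).
rewrite -(size_map (fun B : {fset nat} => subset_sum B %% N)).
apply: uniq_leq_size => [|_ /mapP[B _ ->]]; last first.
  by rewrite mem_iota ltn_pmod.
rewrite map_inj_in_uniq ?fset_uniq // => B C.
by rewrite !fpowersetE => sB sC; apply: dA.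
Qed.

(** All the subset sums are at most the total [S], so they are distinct modulo
    [S + 1], and residues modulo [S + 1] can be counted. *)
Lemma subset_sum_distinct_ge (A : {fset nat}) :
  distinct_subset_sums A -> 2 ^ #|` A| <= (subset_sum A).+1.
Proof.
by move=> dA; apply/card_distinct_subset_sums_mod/distinct_subset_sums_mod_big.
Qed.

(** Two sums below [2 * m] that agree modulo [m] are equal or differ by [m]; in
    the second case adjoining [m] to the subset with the smaller sum produces
    two different subsets of [m |` B] with the same sum. *)
Lemma distinct_subset_sums_mod_last (m : nat) (B : {fset nat}) :
  m \notin B -> distinct_subset_sums (m |` B)%fset -> subset_sum B < 2 * m ->
  distinct_subset_sums_mod m B.
Proof.
move=> mB dmB ltBm C D sC sD.
wlog le_CD : C D sC sD / subset_sum C <= subset_sum D => [IH eqCD|].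
  have [le_CD|/ltnW le_DC] := leqP (subset_sum C) (subset_sum D).
    exact: IH.
  by apply/esym/IH.
move=> /eqP; rewrite eq_sym eqn_mod_dvd // => /dvdnP[k def_k].
have ltDm := leq_ltn_trans (leq_subset_sum _ _ sD) ltBm.
have sBm : (B `<=` m |` B)%fset by apply: fsubsetU1.
have k_lt2 : k < 2 by nia.
case: k k_lt2 def_k => [|[|//]] _ def_k.
  by apply: dmB; rewrite ?(fsubset_trans _ sBm) //; lia.
have mC : m \notin C by apply: contraNN mB; apply: (fsubsetP sC).
have eq_mCD : (m |` C)%fset = D.
  apply: dmB; rewrite ?fsetUS ?(fsubset_trans sD) //.
  by rewrite subset_sum_fsetU1 //; lia.
by case/negP: mB; apply: (fsubsetP sD); rewrite -eq_mCD fset1U1.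
Qed.

(** Removing [m] from a total below [3 * m] leaves less than [2 * m], the range
    in which the subset sums of [B] remain distinct modulo [m]. *)
Lemma last_ge_exp2 (m : nat) (B : {fset nat}) :
  m \notin B -> distinct_subset_sums (m |` B)%fset ->
  subset_sum (m |` B)%fset < 3 * m -> 2 ^ #|` B| <= m.
Proof.
move=> mB dmB; rewrite subset_sum_fsetU1 // => lt3m.
apply: card_distinct_subset_sums_mod; first by lia.
by apply: distinct_subset_sums_mod_last => //; lia.
Qed.

Definition prefix_fset (a : nat -> nat) (i : nat) : {fset nat} :=
  [fset a j | j in iota 1 i]%fset.

Lemma prefix_fsetP (a : nat -> nat) (i x : nat) :
  reflect (exists2 j, 1 <= j <= i & x = a j) (x \in prefix_fset a i).
Proof.
by apply: (iffP (imfsetP _ _ _ _)) => -[j /= j_in ->]; exists j => //;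
  move: j_in; rewrite /= mem_iota add1n ltnS.
Qed.

Lemma prefix_fset0 (a : nat -> nat) : prefix_fset a 0 = fset0%fset.
Proof. by apply/fsetP => x; apply/prefix_fsetP => -[[]]. Qed.

Lemma prefix_fsetS (a : nat -> nat) (i : nat) :
  prefix_fset a i.+1 = (a i.+1 |` prefix_fset a i)%fset.
Proof.
apply/fsetP => x; rewrite in_fset1U; apply/prefix_fsetP/predU1P.
  move=> [j j_in ->].
  have [->|ne_ji] := eqVneq j i.+1; [by left | right].
  by apply/prefix_fsetP; exists j => //; lia.
case=> [->|/prefix_fsetP[j j_in ->]]; first by exists i.+1 => //; lia.
by exists j => //; lia.
Qed.

Lemma prefix_fset_sub (a : nat -> nat) (i n : nat) :
  i <= n -> (prefix_fset a i `<=` prefix_fset a n)%fset.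
Proof.
move=> le_in; apply/fsubsetP => _ /prefix_fsetP[j j_in ->].
by apply/prefix_fsetP; exists j => //; lia.
Qed.

Section IncreasingPrefixes.

Variables (a : nat -> nat) (n : nat).
Hypothesis a_incr : forall i j : nat, 1 <= i -> i < j -> j <= n -> a i < a j.

Lemma prefix_fset_lt (i x : nat) :
  i < n -> x \in prefix_fset a i -> x < a i.+1.
Proof.
move=> lt_in /prefix_fsetP[j /andP[j_gt0 le_ji] ->].
by apply: a_incr; lia.
Qed.

Lemma prefix_fsetN (i : nat) : i < n -> a i.+1 \notin prefix_fset a i.
Proof. by move=> lt_in; apply/negP => /(prefix_fset_lt _ _ lt_in); lia. Qed.

Lemma card_prefix_fset (i : nat) : i <= n -> #|` prefix_fset a i| = i.
Proof.
elim: i => [_|i IHi lt_in].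
  by rewrite prefix_fset0 cardfs0.
by rewrite prefix_fsetS cardfsU1 prefix_fsetN // IHi // ltnW.
Qed.

Lemma fset_max_prefix (i : nat) :
  i < n -> fset_max (prefix_fset a i.+1) <= a i.+1.
Proof.
move=> lt_in; apply/bigmax_leqP_seq => x; rewrite prefix_fsetS in_fset1U.
by case/predU1P=> [->//|x_in _]; apply/ltnW/prefix_fset_lt.
Qed.

Lemma subset_sum_prefix (i : nat) :
  i <= n -> subset_sum (prefix_fset a i) = \sum_(1 <= j < i.+1) a j.
Proof.
elim: i => [_|i IHi lt_in].
  by rewrite prefix_fset0 big_geq // /subset_sum big_seq_fset0.
rewrite prefix_fsetS subset_sum_fsetU1 ?prefix_fsetN // IHi 1?ltnW //.
by rewrite [RHS]big_nat_recr //= addnC.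
Qed.

End IncreasingPrefixes.

Lemma rat_div3_le (N m : nat) :
  (N%:R / 3%:R <= m%:R :> rat)%R -> N <= 3 * m.
Proof.
by rewrite Num.Theory.ler_pdivrMr // -GRing.natrM Num.Theory.ler_nat mulnC.
Qed.

Theorem proposition1p3
  (H : forall t : nat, exists n0 : nat, forall n : nat, n0 <= n ->
    forall A : {fset nat},
      #|` A|%fset = n ->
      positive_elements A ->
      distinct_subset_sums_mod (2 ^ n + t) A ->
      ((2 ^ n + t)%:R / 3%:R <= (fset_max A)%:R :> rat)%R) :
  forall t : nat, exists i0 : nat, forall (n : nat) (a : nat -> nat) (A : {fset nat}),
    A = [fset a i | i in iota 1 n]%fset ->
    (forall i j : nat, 1 <= i -> i < j -> j <= n -> a i < a j) ->
    positive_elements A ->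
    distinct_subset_sums A ->
    \sum_(1 <= i < n.+1) a i < 2 ^ n + t ->
    forall i : nat, 1 <= i -> i0 <= i -> i <= n ->
      2 ^ (i - 1) <= a i <= 2 ^ (i - 1) + t.
Proof.
move=> t; have [n0 Hn0] := H t; exists n0 => n a A -> a_incr.
rewrite -/(prefix_fset a n) => posA dA; rewrite -(subset_sum_prefix _ _ a_incr) // => sumA.
have lower i : n0 <= i.+1 -> i < n ->
    subset_sum (prefix_fset a i.+1) < 2 ^ i.+1 + t -> 2 ^ i <= a i.+1.
  move=> le_n0i lt_in sum_i.
  have sub_i := prefix_fset_sub a _ n lt_in.
  have d_i := distinct_subset_sumsS _ _ sub_i dA.
  have third : 2 ^ i.+1 + t <= 3 * a i.+1.
    have /rat_div3_le := Hn0 _ le_n0i (prefix_fset a i.+1)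
      (card_prefix_fset _ _ a_incr _ lt_in)
      (fun x x_in => posA x (fsubsetP sub_i x x_in))
      (distinct_subset_sums_mod_big _ _ d_i sum_i).
    by have := fset_max_prefix _ _ a_incr _ lt_in; lia.
  rewrite -[in 2 ^ i](card_prefix_fset _ _ a_incr _ (ltnW lt_in)).
  apply: last_ge_exp2; rewrite ?(prefix_fsetN _ n) -?prefix_fsetS //.
  exact: leq_trans sum_i third.
have split_sum i : i < n ->
    subset_sum (prefix_fset a i.+1) = a i.+1 + subset_sum (prefix_fset a i).
  by move=> lt_in; rewrite prefix_fsetS subset_sum_fsetU1 ?(prefix_fsetN _ n).
(* Descending induction on [i], with [k] the distance to [n]: the total drops by
   [a i.+1 >= 2 ^ i], exactly what the bound drops by, so [t] is unchanged. *)
have sum_lt k i : i + k = n -> n0 <= i ->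
    subset_sum (prefix_fset a i) < 2 ^ i + t.
  elim: k i => [|k IHk] i; first by rewrite addn0 => ->.
  move=> def_n le_n0i; have lt_in : i < n by lia.
  have sum_i : subset_sum (prefix_fset a i.+1) < 2 ^ i.+1 + t.
    by apply: IHk; lia.
  have := lower i (leqW le_n0i) lt_in sum_i.
  by move: sum_i; rewrite split_sum // expnS; lia.
case=> // i _ le_n0i lt_in; rewrite subSS subn0.
have sum_i := sum_lt (n - i.+1) i.+1 (subnKC lt_in) le_n0i.
rewrite lower //=.
have := subset_sum_distinct_ge _
  (distinct_subset_sumsS _ _ (prefix_fset_sub a _ n (ltnW lt_in)) dA).
rewrite (card_prefix_fset _ n) ?(ltnW lt_in) //.
by move: sum_i; rewrite split_sum // expnS; lia.
Qed.
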